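(* Let $V$ be a vertex algebra over $\mathbb{C}$. Every endomorphism of the vertex algebra $\mathbb{C}((z))\otimes V$, restricted to $V=1\otimes V$, is a pseudoendomorphism of the vertex algebra $V$. On the other hand, the $\mathbb{C}((z))$-linear extension to $\mathbb{C}((z))\otimes V$ of any pseudoendomorphism of the vertex algebra $V$ is an endomorphism of the vertex algebra $\mathbb{C}((z))\otimes V$. Furthermore, $$\mathrm{PEnd}(V)=\mathrm{End}_{\mathbb{C}((z))}(\mathbb{C}((z))\otimes V),$$ where $\mathrm{End}_{\mathbb{C}((z))}(\mathbb{C}((z))\otimes V)$ stands for the set of all $\mathbb{C}((z))$-linear endomorphisms of the vertex algebra $\mathbb{C}((z))\otimes V$, and the two sides are identified via restriction to $V$ and $\mathbb{C}((z))$-linear extension.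
   Context: Vertex algebras are over $\mathbb{C}$, with vacuum vector $\mathbf{1}$ and vertex operator map $Y\colon V\to \mathrm{Hom}(V,V((x)))$, $Y(v,x)=\sum_{n\in\mathbb{Z}}v_n x^{-n-1}$. The canonical operator $\mathcal{D}$ on $V$ is $\mathcal{D}(v)=v_{-2}\mathbf{1}$; it acts on $\mathbb{C}((z))\otimes V$ as $1\otimes\mathcal{D}$. An endomorphism of a vertex algebra $V$ is a $\mathbb{C}$-linear endomorphism $f$ of $V$ such that $f(\mathbf{1})=\mathbf{1}$ and $fY(u,x)v=Y(f(u),x)f(v)$ for $u,v\in V$. Conventions: $\otimes=\otimes_{\mathbb{C}}$ (the algebraic tensor product), and $z,x$ are formal variables. For $f(z)\in\mathbb{C}((z))$, $f(z+x)=e^{x\,d/dz}f(z)\in\mathbb{C}((z))[[x]]$. If $A(z)v=\sum_i f_i(z)\otimes v_i$ (a finite sum), then $A(z+x)v=\sum_i f_i(z+x)\otimes v_i\in\mathbb{C}((z))[[x]]\otimes V$. The map $Y(\cdot,x)$ is extended $\mathbb{C}((z))[[x]]$-linearly to $\mathbb{C}((z))[[x]]\otimes V$, and the operators $Y(u,x)$ are extended $\mathbb{C}((z))$-linearly to act on $\mathbb{C}((z))\otimes V$. The map $\frac{d}{dz}A(z)$ is $v\mapsto (\frac{d}{dz}\otimes 1)(A(z)v)$. A pseudoendomorphism of $V$ is a $\mathbb{C}$-linear map $A(z)\colon V\to\mathbb{C}((z))\otimes V$ such that $$A(z)\mathbf{1}=\mathbf{1}\ (=1\otimes\mathbf{1}),\qquad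 [\mathcal{D},A(z)]=-\frac{d}{dz}A(z),\qquad A(z)Y(v,x)=Y(A(z+x)v,x)A(z)\ \text{ for } v\in V,$$ as identities of maps on $V$ (with $A(z)$ applied coefficientwise in $x$). $\mathrm{PEnd}(V)$ denotes the set of all pseudoendomorphisms of $V$. There is a natural identification of $\mathbb{C}$-linear maps $V\to\mathbb{C}((z))\otimes V$ with $\mathbb{C}((z))$-linear endomorphisms of the $\mathbb{C}((z))$-vector space $\mathbb{C}((z))\otimes V$, given by $\mathbb{C}((z))$-linear extension, with inverse given by restriction to $1\otimes V$. The vertex algebra $\mathbb{C}((z))\otimes V$ over $\mathbb{C}$ is the tensor product of $V$ with Borcherds' vertex algebra $\mathbb{C}((z))$ (vacuum $1$, $Y(f(z),x)g(z)=f(z+x)g(z)$). Its vacuum is $1\otimes\mathbf{1}$ and its vertex operator map is $$\widehat{Y}(f(z)\otimes u,x)(g(z)\otimes v)=f(z+x)g(z)\otimes Y(u,x)v,\qquad f,g\in\mathbb{C}((z)),\ u,v\in V.$$ *)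

(* Defs.v *)
From HB Require Import structures.
From mathcomp Require Import all_boot all_order all_algebra.
From mathcomp Require Import boolp classical_sets functions cardinality fsbigop.
From mathcomp Require Import zify.

Set Implicit Arguments.
Unset Strict Implicit.
Unset Printing Implicit Defensive.

Import Order.TTheory GRing.Theory Num.Theory.
Local Open Scope classical_set_scope.
Local Open Scope ring_scope.

(******************************************************************************)
(*   laurent M == M((x)), formal Laurent series with coefficients in the      *)
(*                module M; (f : laurent M) n is the coefficient of x^n.      *)
(*                It is a module over the scalars of M.                       *)
(*      lalg R == R((z)) as a commutative R-algebra, with carrier             *)
(*                laurent R^o (R^o is R as a module over itself)              *)
(*    powser M == M[[x]], formal power series (as a module only)              *)
(******************************************************************************)

Record laurent (M : zmodType) : Type := Laurent {
  lcoef :> int -> M;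
  laurentP : exists N : int, forall n : int, n < N -> lcoef n = 0
}.

HB.instance Definition _ (M : zmodType) := gen_eqMixin (laurent M).
HB.instance Definition _ (M : zmodType) := gen_choiceMixin (laurent M).

Lemma laurent_eqP (M : zmodType) (f g : laurent M) : (forall n, f n = g n) -> f = g.
Proof.
case: f g => [f fP] [g gP] /= fg; have {}fg : f = g by apply/funext.
by rewrite fg in fP *; congr Laurent; exact: Prop_irrelevance.
Qed.

Section LaurentModule.
Variable M : zmodType.
Implicit Types f g h : laurent M.

Lemma lzero_bounded : exists N : int, forall n : int, n < N -> 0 = 0 :> M.
Proof. by exists 0. Qed.
Definition lzero : laurent M := Laurent lzero_bounded.

Lemma lopp_bounded f : exists N : int, forall n : int, n < N -> - f n = 0.
Proof. by have [N fN] := laurentP f; exists N => n /fN ->; rewrite oppr0. Qed.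
Definition lopp f : laurent M := Laurent (lopp_bounded f).

Lemma lcommon_bound f g : exists N : int,
  (forall n : int, n < N -> f n = 0) /\ (forall n : int, n < N -> g n = 0).
Proof.
have [[N fN] [P gP]] := (laurentP f, laurentP g).
by exists (Num.min N P); split=> n; rewrite lt_min => /andP[??]; [apply: fN|apply: gP].
Qed.

Lemma ladd_bounded f g : exists N : int, forall n : int, n < N -> f n + g n = 0.
Proof.
by have [N [fN gN]] := lcommon_bound f g; exists N => n nN; rewrite fN ?gN ?addr0.
Qed.
Definition ladd f g : laurent M := Laurent (ladd_bounded f g).

Lemma laddA : associative ladd.
Proof. by move=> f g h; apply: laurent_eqP => n /=; rewrite addrA. Qed.
Lemma laddC : commutative ladd.
Proof. by move=> f g; apply: laurent_eqP => n /=; rewrite addrC. Qed.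
Lemma ladd0 : left_id lzero ladd.
Proof. by move=> f; apply: laurent_eqP => n /=; rewrite add0r. Qed.
Lemma laddN : left_inverse lzero lopp ladd.
Proof. by move=> f; apply: laurent_eqP => n /=; rewrite addNr. Qed.

HB.instance Definition _ := GRing.isZmodule.Build (laurent M) laddA laddC ladd0 laddN.

Lemma lcoefD f g n : (f + g) n = f n + g n. Proof. by []. Qed.
Lemma lcoefN f n : (- f) n = - f n. Proof. by []. Qed.
Lemma lcoef0 n : (0 : laurent M) n = 0. Proof. by []. Qed.

End LaurentModule.

Section LaurentLmodule.
Variables (K : pzRingType) (M : lmodType K).
Implicit Types f g : laurent M.

Lemma lscale_bounded (a : K) f : exists N : int, forall n : int, n < N -> a *: f n = 0.
Proof. by have [N fN] := laurentP f; exists N => n /fN ->; rewrite scaler0. Qed.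
Definition lscale (a : K) f : laurent M := Laurent (lscale_bounded a f).

Lemma lscaleA a b f : lscale a (lscale b f) = lscale (a * b) f.
Proof. by apply: laurent_eqP => n /=; rewrite scalerA. Qed.
Lemma lscale1 : left_id 1 lscale.
Proof. by move=> f; apply: laurent_eqP => n /=; rewrite scale1r. Qed.
Lemma lscaleDr : right_distributive lscale +%R.
Proof. by move=> a f g; apply: laurent_eqP => n /=; rewrite scalerDr. Qed.
Lemma lscaleDl f : {morph lscale^~ f : a b / a + b}.
Proof. by move=> a b; apply: laurent_eqP => n /=; rewrite scalerDl. Qed.

HB.instance Definition _ :=
  GRing.Zmodule_isLmodule.Build K (laurent M) lscaleA lscale1 lscaleDr lscaleDl.

Lemma lcoefZ a f n : (a *: f) n = a *: f n. Proof. by []. Qed.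

End LaurentLmodule.

Section LaurentRing.
Variable K : comNzRingType.
Implicit Types f g h : laurent K^o.

Let vanish (f : int -> K) (N : int) := forall n : int, n < N -> f n = 0.

(* The sum is finite: its support is bounded on both sides. *)
Let conv (f g : int -> K) (n : int) : K := \sum_(i \in [set: int]) f i * g (n - i).

Let convE (f g : int -> K) N P (p : nat) n : vanish f N -> vanish g P -> n < N + P + p%:Z ->
  conv f g n = \sum_(k < p) f (N + k%:Z) * g (n - (N + k%:Z)).
Proof.
move=> fN gP nNP.
have inj : injective (fun k : nat => N + k%:Z) by move=> a b; lia.
rewrite /conv (fsbigE [seq N + k%:Z | k <- iota 0 p])//.
- rewrite big_map -[in RHS](subn0 p) -(big_mkord xpredT
    (fun k => f (N + k%:Z) * g (n - (N + k%:Z)))) subn0 /index_iota subn0.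
  by apply: eq_bigl => k; rewrite in_setT.
- by rewrite map_inj_uniq ?iota_uniq.
- move=> i _ /mapP iNp; have [iN|Ni] := ltP i N; first by rewrite fN ?mul0r.
  rewrite [X in _ * X]gP ?mulr0//; have [ip|] := ltP i (N + p%:Z); last by lia.
  by case: iNp; exists `|i - N|%N; [rewrite mem_iota; lia|lia].
Qed.

Let conv_vanish (f g : int -> K) N P : vanish f N -> vanish g P -> vanish (conv f g) (N + P).
Proof.
move=> fN gP n nNP; rewrite (@convE f g N P 0)//; first by rewrite big_ord0.
by rewrite addr0.
Qed.

Lemma lmul_bounded (f g : laurent K^o) : exists N : int, forall n : int, n < N ->
  \sum_(i \in [set: int]) f i * g (n - i) = 0.
Proof.
by have [[N fN] [P gP]] := (laurentP f, laurentP g); exists (N + P); exact: conv_vanish.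
Qed.
Definition lmul f g : laurent K^o := Laurent (lmul_bounded f g).

Lemma lone_bounded : exists N : int, forall n : int, n < N -> (n == 0)%:R = 0 :> K.
Proof. by exists 0 => n n0; rewrite lt_eqF. Qed.
Definition lone : laurent K^o := @Laurent K^o _ lone_bounded.

Let trunc (p : nat) (N : int) (f : int -> K) : {poly K} := \poly_(i < p) f (N + i%:Z).

Let conv_trunc (f g : int -> K) N P p (q : nat) : vanish f N -> vanish g P -> (q < p)%N ->
  conv f g (N + P + q%:Z) = (trunc p N f * trunc p P g)`_q.
Proof.
move=> fN gP qp; rewrite (@convE f g N P q.+1)//; last by lia.
rewrite coefM; apply: eq_bigr => -[k /= kq] _; rewrite !coef_poly.
rewrite !ifT; [|lia|lia].
by congr (_ * g _); lia.
Qed.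

Let vanish_eq (f g : int -> K) N : vanish f N -> vanish g N ->
  (forall q : nat, f (N + q%:Z) = g (N + q%:Z)) -> f =1 g.
Proof.
move=> fN gN fg n; have [nN|Nn] := ltP n N; first by rewrite fN ?gN.
by have := fg `|n - N|%N; rewrite (_ : N + _ = n)//; lia.
Qed.

Lemma lmulA : associative lmul.
Proof.
move=> f g h; have [[N fN] [P gP]] := (laurentP f, laurentP g).
have [Q hQ] := laurentP h; apply: laurent_eqP.
have fgNP := conv_vanish fN gP; have ghPQ := conv_vanish gP hQ.
have fghl := conv_vanish fgNP hQ; have fghr := conv_vanish fN ghPQ.
apply: (@vanish_eq _ _ (N + P + Q)) => // [n|q].
  by rewrite -addrA; exact: fghr.
rewrite -[LHS]/(conv f (conv g h) _) -[RHS]/(conv (conv f g) h _).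
rewrite (conv_trunc fgNP hQ (ltnSn q)) -[N + P + Q]addrA.
rewrite (conv_trunc fN ghPQ (ltnSn q)).
transitivity ((trunc q.+1 N f * (trunc q.+1 P g * trunc q.+1 Q h))`_q).
  rewrite !coefM; apply: eq_bigr => i _; congr (_ * _).
  by rewrite coef_poly ltnS leq_subr (conv_trunc (p := q.+1) gP hQ) // ltnS leq_subr.
rewrite mulrA !coefM; apply: eq_bigr => -[i iq] _; congr (_ * _).
by rewrite [RHS]coef_poly iq (conv_trunc fN gP iq).
Qed.

Lemma lmulC : commutative lmul.
Proof.
move=> f g; have [[N fN] [P gP]] := (laurentP f, laurentP g); apply: laurent_eqP.
have fg := conv_vanish fN gP; have gf := conv_vanish gP fN.
apply: (@vanish_eq _ _ (N + P)) => // [n|q]; first by rewrite addrC; exact: gf.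
rewrite -[LHS]/(conv f g _) -[RHS]/(conv g f _).
by rewrite (conv_trunc fN gP (ltnSn q)) [N + P]addrC (conv_trunc gP fN (ltnSn q)) mulrC.
Qed.

Lemma lmul1 : left_id lone lmul.
Proof.
move=> f; apply: laurent_eqP => n /=; rewrite (fsbigE [:: 0])//.
  by rewrite big_mkcond big_seq1 in_setT eqxx mul1r subr0.
by move=> i _; rewrite inE => /negPf ->; rewrite mul0r.
Qed.

Lemma lmulDl : left_distributive lmul +%R.
Proof.
move=> f g h; have [[N [fN gN]] [P hP]] := (lcommon_bound f g, laurentP h).
apply: laurent_eqP => n; pose p := `|(n - N - P)%R|%N.+1.
have np : n < N + P + p%:Z by rewrite /p; lia.
have fgN : vanish (f + g) N by move=> m mN; rewrite lcoefD fN ?gN ?addr0.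
rewrite lcoefD -[LHS]/(conv (f + g) h n) -[RHS]/(conv f h n + conv g h n).
rewrite (convE fgN hP np) (convE fN hP np) (convE gN hP np) -big_split.
by apply: eq_bigr => i _; rewrite lcoefD mulrDl.
Qed.

Lemma lone_neq0 : lone != 0.
Proof. by apply/eqP => /(congr1 (fun f : laurent K^o => f 0)) /eqP; rewrite /= oner_eq0. Qed.

HB.instance Definition _ := GRing.Zmodule_isComNzRing.Build (laurent K^o)
  lmulA lmulC lmul1 lmulDl lone_neq0.

Lemma lmul_scaleAl (a : K) f g : a *: (f * g) = (a *: f) * g.
Proof.
have [[N fN] [P gP]] := (laurentP f, laurentP g).
apply: laurent_eqP => n; pose p := `|(n - N - P)%R|%N.+1.
have np : n < N + P + p%:Z by rewrite /p; lia.
have afN : vanish (a *: f) N by move=> m mN; rewrite lcoefZ fN ?scaler0.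
rewrite lcoefZ -[LHS]/(a * conv f g n) -[RHS]/(conv (a *: f) g n).
rewrite (convE fN gP np) (convE afN gP np) mulr_sumr.
by apply: eq_bigr => i _; rewrite lcoefZ mulrA.
Qed.

HB.instance Definition _ :=
  GRing.Lmodule_isLalgebra.Build K (laurent K^o) lmul_scaleAl.
HB.instance Definition _ := GRing.Lalgebra_isComAlgebra.Build K (laurent K^o).

Definition lalg : comAlgType K := laurent K^o.

Lemma lcoefM f g n : (f * g) n = \sum_(i \in [set: int]) f i * g (n - i).
Proof. by []. Qed.
Lemma lcoef1 n : (1 : laurent K^o) n = (n == 0)%:R. Proof. by []. Qed.

End LaurentRing.

Definition powser (M : Type) : Type := nat -> M.
HB.instance Definition _ (M : zmodType) := GRing.Zmodule.on (powser M).
HB.instance Definition _ (K : pzRingType) (M : lmodType K) :=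
  GRing.Lmodule.copy (powser M) (nat -> M).

(******************************************************************************)
(*       tensor M N == M ⊗ N, for modules M, N over a commutative ring K      *)
(*           m ⊗ n == pure tensor                                             *)
(*    tens_lift B t == value at t : tensor M N of the map induced by a bilinear*)
(*                     B : M -> N -> W (meaningless if B is not bilinear)     *)
(*   tens_map f g t == value at t of f ⊗ g                                    *)
(******************************************************************************)

Definition is_bilinear (K : comNzRingType) (M N W : lmodType K) (B : M -> N -> W) : Prop :=
  (forall n, linear (B^~ n)) /\ (forall m, linear (B m)).

Section Tensor.
Variables (K : comNzRingType) (M N : lmodType K).

(* A finite formal sum of pure tensors is a list of pairs. Opposites need no  *)
(* separate generator since -(m ⊗ n) = (-m) ⊗ n.                              *)
Inductive tens_rel : seq (M * N) -> seq (M * N) -> Prop :=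
| TensRefl s : tens_rel s s
| TensSym s t : tens_rel s t -> tens_rel t s
| TensTrans s t u : tens_rel s t -> tens_rel t u -> tens_rel s u
| TensCat s s' t t' : tens_rel s s' -> tens_rel t t' -> tens_rel (s ++ t) (s' ++ t')
| TensComm s t : tens_rel (s ++ t) (t ++ s)
| TensZero n : tens_rel [:: (0, n)] [::]
| TensAddl m m' n : tens_rel [:: (m + m', n)] [:: (m, n); (m', n)]
| TensAddr m n n' : tens_rel [:: (m, n + n')] [:: (m, n); (m, n')]
| TensScale a m n : tens_rel [:: (a *: m, n)] [:: (m, a *: n)].

Definition tens_eqv : rel (seq (M * N)) := fun s t => `[< tens_rel s t >].

Lemma tens_eqv_refl : reflexive tens_eqv.
Proof. by move=> s; apply/asboolP; exact: TensRefl. Qed.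
Lemma tens_eqv_sym : symmetric tens_eqv.
Proof. by move=> s t; apply/asboolP/asboolP; exact: TensSym. Qed.
Lemma tens_eqv_trans : transitive tens_eqv.
Proof.
by move=> t s u /asboolP st /asboolP tu; apply/asboolP; exact: TensTrans st tu.
Qed.

Canonical tens_equiv := EquivRel tens_eqv tens_eqv_refl tens_eqv_sym tens_eqv_trans.

Definition tensor : Type := {eq_quot tens_equiv}%qT.
HB.instance Definition _ := Choice.on tensor.

Definition tens_of (s : seq (M * N)) : tensor := \pi_({eq_quot tens_equiv})%qT s.
Definition tens_repr (t : tensor) : seq (M * N) := repr t.

Lemma tens_reprK t : tens_of (tens_repr t) = t.
Proof. exact: reprK. Qed.

Lemma tens_ofP s t : tens_of s = tens_of t <-> tens_rel s t.
Proof.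
split=> [/eqP|st]; first by rewrite eqmodE => /asboolP.
by apply/eqP; rewrite eqmodE; apply/asboolP.
Qed.

Lemma tens_repr_of s : tens_rel (tens_repr (tens_of s)) s.
Proof. by apply/tens_ofP; rewrite tens_reprK. Qed.

Definition tadd (t u : tensor) : tensor := tens_of (tens_repr t ++ tens_repr u).

Lemma tadd_of s t : tadd (tens_of s) (tens_of t) = tens_of (s ++ t).
Proof. by apply/tens_ofP/TensCat; exact: tens_repr_of. Qed.

Definition tsscale (a : K) (s : seq (M * N)) := [seq (a *: p.1, p.2) | p <- s].

Lemma tsscale_rel a s t : tens_rel s t -> tens_rel (tsscale a s) (tsscale a t).
Proof.
elim=> {s t} [s|s t _ st|s t u _ st _ tu|s s' t t' _ ss' _ tt'|s t|n|m m' n|m n n'|b m n].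
- exact: TensRefl.
- exact: TensSym.
- exact: TensTrans st tu.
- by rewrite /tsscale !map_cat; exact: TensCat.
- by rewrite /tsscale !map_cat; exact: TensComm.
- by rewrite /= scaler0; exact: TensZero.
- by rewrite /= scalerDr; exact: TensAddl.
- exact: TensAddr.
- by rewrite /= scalerA mulrC -scalerA; exact: TensScale.
Qed.

Definition tscale (a : K) (t : tensor) : tensor := tens_of (tsscale a (tens_repr t)).

Lemma tscale_of a s : tscale a (tens_of s) = tens_of (tsscale a s).
Proof. by apply/tens_ofP/tsscale_rel/tens_repr_of. Qed.

Lemma taddA : associative tadd.
Proof.
move=> t u v; rewrite -[t]tens_reprK -[u]tens_reprK -[v]tens_reprK.
by rewrite !tadd_of catA.
Qed.
Lemma taddC : commutative tadd.
Proof. by move=> t u; apply/tens_ofP/TensComm. Qed.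
Lemma tadd0 : left_id (tens_of [::]) tadd.
Proof. by move=> t; rewrite -[t]tens_reprK tadd_of. Qed.

Lemma tsscaleDl a b s : tens_rel (tsscale (a + b) s) (tsscale a s ++ tsscale b s).
Proof.
elim: s => [|[m n] s IHs] /=; first exact: TensRefl.
rewrite scalerDl -cat1s -[in X in tens_rel _ X]cat1s.
set sa := tsscale a s; set sb := tsscale b s.
apply: (@TensTrans _ ([:: (a *: m, n); (b *: m, n)] ++ (sa ++ sb))).
  exact: TensCat (TensAddl _ _ _) IHs.
rewrite -cat1s -!catA; apply: TensCat; first exact: TensRefl.
rewrite -[(b *: m, n) :: sb]cat1s !catA; apply: TensCat (TensRefl _).
exact: TensComm.
Qed.

Lemma tsscale0 s : tens_rel (tsscale 0 s) [::].
Proof.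
elim: s => [|[m n] s IHs] /=; first exact: TensRefl.
by rewrite scale0r -cat1s -[[::]]/([::] ++ [::]); exact: TensCat (TensZero _) IHs.
Qed.

Lemma tsscale1 s : tsscale 1 s = s.
Proof. by rewrite -[RHS]map_id; apply: eq_map => -[m n]; rewrite /= scale1r. Qed.

Lemma taddN : left_inverse (tens_of [::]) (tscale (-1)) tadd.
Proof.
move=> t; rewrite -[t]tens_reprK tscale_of tadd_of; set s := tens_repr t.
apply/tens_ofP; apply: TensTrans (tsscale0 s).
by rewrite -[0](addNr 1) -[X in tens_rel (_ ++ X)]tsscale1; exact/TensSym/tsscaleDl.
Qed.

HB.instance Definition _ := GRing.isZmodule.Build tensor taddA taddC tadd0 taddN.

Lemma tens_ofD s t : tens_of (s ++ t) = tens_of s + tens_of t.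
Proof. exact/esym/tadd_of. Qed.

Lemma tscaleA a b t : tscale a (tscale b t) = tscale (a * b) t.
Proof.
rewrite -[t]tens_reprK !tscale_of; congr tens_of.
by rewrite /tsscale -map_comp; apply: eq_map => -[m n]; rewrite /= scalerA.
Qed.
Lemma tscale1 : left_id 1 tscale.
Proof. by move=> t; rewrite -[t]tens_reprK tscale_of tsscale1. Qed.
Lemma tscaleDr : right_distributive tscale +%R.
Proof.
move=> a t u; rewrite -[t]tens_reprK -[u]tens_reprK -tens_ofD !tscale_of -tens_ofD.
by rewrite /tsscale map_cat.
Qed.
Lemma tscaleDl t : {morph tscale^~ t : a b / a + b}.
Proof.
move=> a b; rewrite -[t]tens_reprK !tscale_of -tens_ofD.
exact/tens_ofP/tsscaleDl.
Qed.

HB.instance Definition _ :=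
  GRing.Zmodule_isLmodule.Build K tensor tscaleA tscale1 tscaleDr tscaleDl.

Definition pure (m : M) (n : N) : tensor := tens_of [:: (m, n)].

Lemma pure_bilinear : is_bilinear pure.
Proof.
split=> [n a m m'|m a n n'].
  rewrite -[_ *: pure _ _]/(tscale _ _) tscale_of -tens_ofD.
  exact/tens_ofP/TensAddl.
rewrite -[_ *: pure _ _]/(tscale _ _) tscale_of -tens_ofD; apply/tens_ofP.
apply: TensTrans (TensAddr _ _ _) _; apply: (TensCat (s := [:: _])) (TensRefl _).
exact/TensSym/TensScale.
Qed.

(* Every tensor is a finite sum of pure tensors. *)
Lemma tensorE t : t = \sum_(p <- tens_repr t) pure p.1 p.2.
Proof.
rewrite -[LHS]tens_reprK; elim: (tens_repr t) => [|[m n] s IHs].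
  by rewrite big_nil.
by rewrite big_cons -cat1s tens_ofD IHs.
Qed.

Section Lift.
Variables (W : lmodType K) (B : M -> N -> W).

Definition tens_lift (t : tensor) : W := \sum_(p <- tens_repr t) B p.1 p.2.

Hypothesis B_bilin : is_bilinear B.

Let Bl n : {linear M -> W} :=
  HB.pack (B^~ n) (GRing.isLinear.Build _ _ _ _ (B^~ n) (B_bilin.1 n)).
Let Br m : {linear N -> W} :=
  HB.pack (B m) (GRing.isLinear.Build _ _ _ _ (B m) (B_bilin.2 m)).

Lemma tens_lift_rel s t : tens_rel s t ->
  \sum_(p <- s) B p.1 p.2 = \sum_(p <- t) B p.1 p.2.
Proof.
elim=> {s t} [s|s t _ ->//|s t u _ -> _ ->//|s s' t t' _ + _|s t|n|m m' n|m n n'|b m n].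
- by [].
- by rewrite !big_cat => -> /= ->.
- by rewrite !big_cat /= addrC.
- by rewrite big_seq1 big_nil; exact: (linear0 (Bl n)).
- by rewrite !big_cons !big_nil !addr0; exact: (linearD (Bl n)).
- by rewrite !big_cons !big_nil !addr0; exact: (linearD (Br m)).
- rewrite !big_seq1; transitivity (b *: B m n); first exact: (linearZZ (Bl n)).
  exact/esym/(linearZZ (Br m)).
Qed.

Lemma tens_lift_of s : tens_lift (tens_of s) = \sum_(p <- s) B p.1 p.2.
Proof. exact/tens_lift_rel/tens_repr_of. Qed.

Lemma tens_lift_pure m n : tens_lift (pure m n) = B m n.
Proof. by rewrite tens_lift_of big_seq1. Qed.

Lemma tens_lift_linear : linear tens_lift.
Proof.
move=> a t u; rewrite -[t]tens_reprK -[u]tens_reprK -[_ *: _]/(tscale _ _).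
rewrite tscale_of -tens_ofD !tens_lift_of big_cat big_map scaler_sumr /=.
by congr (_ + _); apply: eq_bigr => -[m n] _; exact: (linearZZ (Bl n)).
Qed.

End Lift.

End Tensor.

Notation "m ⊗ n" := (pure m n) (at level 40, no associativity) : ring_scope.

Definition tens_map (K : comNzRingType) (M M' N N' : lmodType K)
    (f : M -> M') (g : N -> N') (t : tensor M N) : tensor M' N' :=
  tens_lift (fun m n => f m ⊗ g n) t.

(* The same abelian group as tensor L V, but as a module over L. *)
Definition scalar_ext (K : comNzRingType) (L : comAlgType K) (V : lmodType K) : Type :=
  tensor L V.
HB.instance Definition _ (K : comNzRingType) (L : comAlgType K) (V : lmodType K) :=
  GRing.Zmodule.on (scalar_ext L V).

Section ScalarExt.
Variables (K : comNzRingType) (L : comAlgType K) (V : lmodType K).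

Definition escale (g : L) (t : scalar_ext L V) : scalar_ext L V :=
  tens_lift (fun f v => (g * f) ⊗ v) t.

Lemma escale_bilin g : is_bilinear (fun (f : L) (v : V) => (g * f) ⊗ v).
Proof.
have [pl pr] := pure_bilinear L V; split=> [v a f f'|f]; last exact: pr.
by rewrite mulrDr -scalerAr; exact: pl.
Qed.

Lemma escale_pure g f v : escale g (f ⊗ v) = (g * f) ⊗ v.
Proof. exact/tens_lift_pure/escale_bilin. Qed.

Lemma escale_linear g : linear (escale g : tensor L V -> tensor L V).
Proof. exact/tens_lift_linear/escale_bilin. Qed.

Lemma escaleDr : right_distributive escale +%R.
Proof. by move=> g t u; have := escale_linear g 1 t u; rewrite !scale1r. Qed.

Let escale_sum g (I : Type) (r : seq I) (F : I -> tensor L V) :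
  escale g (\sum_(i <- r) F i) = \sum_(i <- r) escale g (F i).
Proof.
apply: (big_morph (escale g) (escaleDr g)).
by have := escale_linear g (-1) 0 0; rewrite scaleN1r oppr0 addr0 scaleN1r addNr.
Qed.

Lemma escaleA g h t : escale g (escale h t) = escale (g * h) t.
Proof.
rewrite [t]tensorE !escale_sum; apply: eq_bigr => -[f v] _ /=.
by rewrite !escale_pure mulrA.
Qed.

Lemma escale1 : left_id 1 escale.
Proof.
move=> t; rewrite [t]tensorE escale_sum; apply: eq_bigr => -[f v] _ /=.
by rewrite escale_pure mul1r.
Qed.

Lemma escaleDl t : {morph escale^~ t : g h / g + h}.
Proof.
move=> g h; rewrite [t]tensorE !escale_sum -big_split; apply: eq_bigr => -[f v] _ /=.
have [pl _] := pure_bilinear L V.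
by rewrite !escale_pure mulrDl; have := pl v 1 (g * f) (h * f); rewrite !scale1r.
Qed.

HB.instance Definition _ := GRing.Zmodule_isLmodule.Build L (scalar_ext L V)
  escaleA escale1 escaleDr escaleDl.

End ScalarExt.

(******************************************************************************)
(*  Vertex algebras. vertex_op u v is Y(u, x)v : V((x)).                      *)
(******************************************************************************)

Record vertexData (K : pzRingType) := VertexData {
  va_sort :> lmodType K;
  vac : va_sort;
  vertex_op : va_sort -> va_sort -> laurent va_sort
}.
Arguments vac {K}.
Arguments vertex_op {K v} : rename.

(* u_n v, the coefficient of x^(-n-1) in Y(u, x)v *)
Definition nprod (K : pzRingType) (V : vertexData K) (n : int) (u v : V) : V :=
  vertex_op u v (- n - 1).

Definition canonical_D (K : pzRingType) (V : vertexData K) (v : V) : V :=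
  nprod (- 2) v (vac V).

(* The binomial coefficient m (m - 1) ... (m - i + 1) / i! for m : int. *)
Definition binz (K : fieldType) (m : int) (i : nat) : K :=
  (\prod_(j < i) (m - j%:Z)%:~R) / (i`!)%:R.

(* va_jacobi is the Jacobi identity
     x0^-1 delta((x1 - x2) / x0) Y(u, x1) Y(v, x2) w
       - x0^-1 delta((x2 - x1) / - x0) Y(v, x2) Y(u, x1) w
     = x2^-1 delta((x1 - x0) / x2) Y(Y(u, x0) v, x2) w
   at the coefficient of x0^(-l-1) x1^(-m-1) x2^(-n-1). The sums have finite
   support, because Y(a, x)b has finitely many negative powers of x. *)
Record is_vertex_algebra (K : numFieldType) (V : vertexData K) : Prop := IsVertexAlgebra {
  va_bilinear : is_bilinear (vertex_op : V -> V -> laurent V);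
  va_vacuum : forall (v : V) (n : int),
    vertex_op (vac V) v n = if n == 0 then v else 0;
  va_creation : forall v : V, vertex_op v (vac V) 0 = v /\
    forall n : int, n < 0 -> vertex_op v (vac V) n = 0;
  va_jacobi : forall (u v w : V) (l m n : int),
    \sum_(i \in [set: nat])
      ((-1) ^+ i * binz K l i) *:
        (nprod (m + l - i%:Z) u (nprod (n + i%:Z) v w)
         - (-1) ^ l *: nprod (n + l - i%:Z) v (nprod (m + i%:Z) u w))
    = \sum_(i \in [set: nat])
        binz K m i *: nprod (m + n - i%:Z) (nprod (l + i%:Z) u v) w
}.

Definition va_End (K : numFieldType) (V : vertexData K) : set (V -> V) :=
  [set f | [/\ linear f, f (vac V) = vac V &
    forall (u v : V) (n : int), f (vertex_op u v n) = vertex_op (f u) (f v) n]].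
Arguments va_End {K} V _.

(******************************************************************************)
(*  The vertex algebra K((z)) ⊗ V, over a field K of characteristic 0.        *)
(******************************************************************************)

Section LaurentExtension.
Variable K : numFieldType.
Local Notation L := (lalg K).

Lemma deriv_bounded (f : laurent K^o) : exists N : int, forall n : int, n < N ->
  (n + 1)%:~R * f (n + 1) = 0 :> K^o.
Proof.
have [N fN] := laurentP f; exists (N - 1) => n nN.
have -> : f (n + 1) = 0 by apply: fN; lia.
exact: mulr0.
Qed.

Definition lderiv (f : laurent K^o) : laurent K^o := Laurent (deriv_bounded f).

(* f(z + x) = e^(x d/dz) f(z), in K((z))[[x]] *)
Definition zshift (f : L) : powser L := fun k => (k`!)%:R^-1 *: iter k lderiv f.

Variable V : vertexData K.
Local Notation T := (tensor L V).
Local Notation E := (scalar_ext L V).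

Lemma psact_bounded (F : powser L) (S : laurent T) : exists N : int,
  forall n : int, n < N -> \sum_(k \in [set: nat]) escale (F k) (S (n - k%:Z)) = 0 :> T.
Proof.
have [N SN] := laurentP S; exists N => n nN; apply: fsbig1 => k _.
have -> : S (n - k%:Z) = 0 by apply: SN; lia.
exact: (@scaler0 L E).
Qed.

(* The action of K((z))[[x]] on (K((z)) ⊗ V)((x)) by multiplication of series *)
Definition psact (F : powser L) (S : laurent T) : laurent T :=
  Laurent (psact_bounded F S).

Lemma pstens_bounded (F : powser L) (w : laurent V) : exists N : int,
  forall n : int, n < N -> \sum_(k \in [set: nat]) F k ⊗ w (n - k%:Z) = 0 :> T.
Proof.
have [N wN] := laurentP w; exists N => n nN; apply: fsbig1 => k _.
rewrite wN; last by lia.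
have := (pure_bilinear L V).2 (F k) (-1) 0 0.
by rewrite scaleN1r oppr0 addr0 scaleN1r addNr.
Qed.

(* F(z, x) ⊗ w(x), in (K((z)) ⊗ V)((x)) *)
Definition pstens (F : powser L) (w : laurent V) : laurent T :=
  Laurent (pstens_bounded F w).

Lemma ltens_bounded (g : L) (w : laurent V) : exists N : int,
  forall n : int, n < N -> g ⊗ w n = 0 :> T.
Proof.
have [N wN] := laurentP w; exists N => n /wN ->.
have := (pure_bilinear L V).2 g (-1) 0 0.
by rewrite scaleN1r oppr0 addr0 scaleN1r addNr.
Qed.

(* g(z) ⊗ w(x), in (K((z)) ⊗ V)((x)) *)
Definition ltens (g : L) (w : laurent V) : laurent T := Laurent (ltens_bounded g w).

(* (f(z) ⊗ u, g(z) ⊗ v) |-> f(z + x) g(z) ⊗ Y(u, x)v *)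
Definition ext_vertex_op (t s : T) : laurent T :=
  tens_lift (fun f u => tens_lift (fun g v =>
    pstens (fun k => zshift f k * g) (vertex_op u v)) s) t.

Definition laurent_ext : vertexData K :=
  @VertexData K T (1 ⊗ vac V) ext_vertex_op.

(* Y(u, x), extended K((z))-linearly to K((z)) ⊗ V *)
Definition vertex_op_lin (u : V) (s : T) : laurent T :=
  tens_lift (fun g v => ltens g (vertex_op u v)) s.

(* Y(a, x)s for a in K((z))[[x]] ⊗ V, the K((z))[[x]]-linear extension in a *)
Definition vertex_op_ext (a : tensor (powser L) V) (s : T) : laurent T :=
  tens_lift (fun F u => psact F (vertex_op_lin u s)) a.

(* A(z)v |-> A(z + x)v *)
Definition tshift (t : T) : tensor (powser L) V := tens_map zshift id t.

Definition PEnd : set (V -> T) :=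
  [set A | [/\ linear A,
    A (vac V) = 1 ⊗ vac V,
    forall v, tens_map id (@canonical_D K V) (A v) - A (canonical_D v)
              = - tens_map lderiv id (A v) &
    forall (v w : V) (n : int),
      A (vertex_op v w n) = vertex_op_ext (tshift (A v)) (A w) n]].

(* The K((z))-linear endomorphisms of the vertex algebra K((z)) ⊗ V *)
Definition va_End_Laurent : set (T -> T) :=
  [set f | va_End laurent_ext f /\ linear (f : E -> E)].

Definition restrict_to_V (f : T -> T) : V -> T := fun v => f (1 ⊗ v).

Definition linear_ext (A : V -> T) : T -> T :=
  tens_lift (fun g v => (g *: (A v : E) : T)).

End LaurentExtension.
Arguments laurent_ext {K} V.
Arguments PEnd {K} V _.
Arguments va_End_Laurent {K} V _.

(* Main.v *)
Require Import Defs.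
From mathcomp Require Import all_boot all_order all_algebra.
From mathcomp Require Import boolp classical_sets functions reals complex.
From mathcomp Require Import fsbigop zify.

Set Implicit Arguments.
Unset Strict Implicit.
Unset Printing Implicit Defensive.

Import Order.TTheory GRing.Theory Num.Theory.
Local Open Scope classical_set_scope.
Local Open Scope ring_scope.

(** The vertex operator of K((z)) ⊗ V is a deformation of the extension of
    scalars of Y: moving the argument f(z) of f ⊗ u to f(z + x) turns one into
    the other, so that Y^(t, x)s = Y(t(z + x), x)s for all tensors t and s
    ([ext_vertex_opE]). Hence, for A(z) = f restricted to 1 ⊗ V, the identity
    A(z)Y(v, x) = Y(A(z + x)v, x)A(z) is literally the homomorphism property of
    f at the pair 1 ⊗ v, 1 ⊗ w. The bracket identity comes from the fact that f
    preserves the vacuum and products, hence commutes with the canonical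
    operator, which on K((z)) ⊗ V is d/dz ⊗ 1 + 1 ⊗ D ([canonical_D_ext]); the
    first summand kills 1 ⊗ v.

    Conversely, a pseudoendomorphism satisfies the homomorphism property on
    1 ⊗ V, and it remains to let scalars in. Replacing t by f(z)t and s by g(z)s
    multiplies Y^(t, x)s by f(z + x)g(z) ([ext_vertex_op_scale]), because
    f |-> f(z + x) is a ring morphism ([zshiftM], a form of the Leibniz rule).
    The K((z))-linear extension commutes with multiplication by f(z + x)g(z),
    coefficient by coefficient, so the property extends to pure tensors f ⊗ u
    and g ⊗ v, and to all tensors by additivity.

    Finally, a K((z))-linear map on K((z)) ⊗ V is determined by its values on
    1 ⊗ V, so restriction and extension are inverse to each other.

    All the series in x that occur are bounded below, so each coefficient is a
    finite sum over an explicit initial segment of the naturals, which is the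
    form in which these sums are manipulated. *)

(** * Finite sums, linear maps and tensors *)

Lemma fsum_ord (M : nmodType) (F : nat -> M) (p : nat) :
  (forall k, (p <= k)%N -> F k = 0) -> \sum_(k \in [set: nat]) F k = \sum_(k < p) F k.
Proof.
move=> F0; rewrite (fsbigE (iota 0 p)) ?iota_uniq//; last first.
  by move=> k _; rewrite mem_iota => kp; apply: F0; lia.
rewrite -(big_mkord xpredT) /index_iota subn0.
by apply: eq_bigl => k; rewrite in_setT.
Qed.

(* [linear] is used here as a predicate on bare functions: the maps attached to
   a vertex algebra are linear only under hypotheses, and are not bundled. *)
Section LinearPredicate.
Variables (K : pzRingType) (M W : lmodType K).
Implicit Types f : M -> W.

Lemma linear_pred_add f : linear f -> {morph f : x y / x + y}.
Proof. by move=> lf x y; have := lf 1 x y; rewrite !scale1r. Qed.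

Lemma linear_pred0 f : linear f -> f 0 = 0.
Proof. by move=> lf; have := lf (-1) 0 0; rewrite scaleN1r oppr0 addr0 scaleN1r addNr. Qed.

Lemma linear_predZ f : linear f -> forall a, {morph f : x / a *: x}.
Proof. by move=> lf a x; have := lf a x 0; rewrite (linear_pred0 lf) !addr0. Qed.

Lemma linear_pred_sum f : linear f -> forall (I : Type) (r : seq I) (F : I -> M),
  f (\sum_(i <- r) F i) = \sum_(i <- r) f (F i).
Proof. by move=> lf I r F; exact: (big_morph f (linear_pred_add lf) (linear_pred0 lf)). Qed.

Lemma linear_pred_bigsum (I : Type) (r : seq I) (G : I -> M -> W) :
  (forall i, linear (G i)) -> linear (fun x => \sum_(i <- r) G i x).
Proof.
move=> lG a x y; rewrite scaler_sumr -big_split.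
by apply: eq_bigr => i _; exact: lG.
Qed.

End LinearPredicate.

Section Tensors.
Variables (K : comNzRingType) (M N : lmodType K).

Lemma tensor_additive_eq (W : zmodType) (f g : tensor M N -> W) :
  {morph f : x y / x + y} -> {morph g : x y / x + y} ->
  (forall m n, f (m ⊗ n) = g (m ⊗ n)) -> f =1 g.
Proof.
move=> fD gD fg t.
have z (h : tensor M N -> W) : {morph h : x y / x + y} -> h 0 = 0.
  by move=> hD; apply: (addrI (h 0)); rewrite -hD !addr0.
rewrite [t]tensorE (big_morph f fD (z f fD)) (big_morph g gD (z g gD)).
by apply: eq_bigr => p _; exact: fg.
Qed.

(** The sum over a representative of t is linear in any parameter in which B is,
    even when no bilinearity of B u is known. *)
Lemma tens_lift_linear_param (U W : lmodType K) (B : U -> M -> N -> W) t :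
  (forall m n, linear (fun u => B u m n)) -> linear (fun u => tens_lift (B u) t).
Proof. by move=> lB; apply: linear_pred_bigsum => p; exact: lB. Qed.

Lemma pure0r (m : M) : m ⊗ 0 = 0 :> tensor M N.
Proof. exact: (linear_pred0 ((pure_bilinear M N).2 m)). Qed.

Lemma pure0l (n : N) : 0 ⊗ n = 0 :> tensor M N.
Proof. exact: (linear_pred0 ((pure_bilinear M N).1 n)). Qed.

Lemma pureZl a (m : M) (n : N) : (a *: m) ⊗ n = a *: (m ⊗ n).
Proof. exact: (linear_predZ ((pure_bilinear M N).1 n)). Qed.

Lemma pureZr a (m : M) (n : N) : m ⊗ (a *: n) = a *: (m ⊗ n).
Proof. exact: (linear_predZ ((pure_bilinear M N).2 m)). Qed.

Lemma pureDl (m m' : M) (n : N) : (m + m') ⊗ n = m ⊗ n + m' ⊗ n.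
Proof. exact: (linear_pred_add ((pure_bilinear M N).1 n)). Qed.

Lemma pureDr (m : M) (n n' : N) : m ⊗ (n + n') = m ⊗ n + m ⊗ n'.
Proof. exact: (linear_pred_add ((pure_bilinear M N).2 m)). Qed.

End Tensors.

Section TensMap.
Variables (K : comNzRingType) (M M' N N' : lmodType K) (f : M -> M') (g : N -> N').
Hypotheses (lf : linear f) (lg : linear g).

Lemma tens_map_bilinear : is_bilinear (fun m n => f m ⊗ g n).
Proof.
split=> [n a m m'|m a n n']; first by rewrite lf pureDl pureZl.
by rewrite lg pureDr pureZr.
Qed.

Lemma tens_map_pure m n : tens_map f g (m ⊗ n) = f m ⊗ g n.
Proof. exact/tens_lift_pure/tens_map_bilinear. Qed.

Lemma tens_map_linear : linear (tens_map f g).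
Proof. exact/tens_lift_linear/tens_map_bilinear. Qed.

End TensMap.

(** * Formal derivative and translation of Laurent series *)

Section Derivative.
Variable K : numFieldType.
Local Notation L := (lalg K).
Implicit Types f g : L.

(** The product as a finite sum over indices starting at a given bound N, which
    can be shared by several products. *)
Lemma lcoefM_trunc (f g : L) (N P : int) (p : nat) (n : int) :
  (forall m : int, m < N -> lcoef f m = 0) -> (forall m : int, m < P -> lcoef g m = 0) ->
  n < N + P + p%:Z ->
  lcoef (f * g) n = \sum_(k < p) (lcoef f (N + k%:Z) : K) * lcoef g (n - (N + k%:Z)).
Proof.
move=> fN gP nNP; rewrite lcoefM.
have inj : injective (fun k : nat => N + k%:Z) by move=> a b; lia.
rewrite (fsbigE [seq N + k%:Z | k <- iota 0 p])//.
- rewrite big_map -(big_mkord xpredT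
    (fun k => (lcoef f (N + k%:Z) : K) * lcoef g (n - (N + k%:Z)))) /index_iota subn0.
  by apply: eq_bigl => k; rewrite in_setT.
- by rewrite map_inj_uniq ?iota_uniq.
- move=> i _ /mapP iNp; have [iN|Ni] := ltP i N; first by rewrite fN ?mul0r.
  rewrite [X in _ * X]gP ?mulr0//; have [ip|] := ltP i (N + p%:Z); last by lia.
  by case: iNp; exists `|i - N|%N; [rewrite mem_iota; lia|lia].
Qed.

Lemma lderiv_linear : linear (@lderiv K : L -> L).
Proof.
move=> a f g; apply: laurent_eqP => n.
rewrite lcoefD lcoefZ /= mulrDr; congr (_ + _).
by rewrite mulrCA.
Qed.

Lemma lderivM f g : lderiv (f * g) = lderiv f * g + f * lderiv g :> L.
Proof.
have [[N fN] [P gP]] := (laurentP f, laurentP g).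
have dP (h : L) (Q : int) : (forall m : int, m < Q -> lcoef h m = 0) ->
    forall m : int, m < Q - 1 -> lcoef (lderiv h) m = 0.
  by move=> hQ m mQ; rewrite /= hQ ?mulr0//; lia.
apply: laurent_eqP => n; rewrite lcoefD; pose p := `|(n + 2 - N - P)%R|%N.+1.
(* Taking N - 1 as the bound for f' makes its k-th term contain the coefficient
   of f at N + k, as in the other two sums: all three match term by term. *)
rewrite (@lcoefM_trunc (lderiv f) g (N - 1) P p n (dP _ _ fN) gP); last by rewrite /p; lia.
rewrite (@lcoefM_trunc f (lderiv g) N (P - 1) p n fN (dP _ _ gP)); last by rewrite /p; lia.
rewrite -[LHS]/((n + 1)%:~R * lcoef (f * g) (n + 1) : K).
rewrite (@lcoefM_trunc f g N P p (n + 1) fN gP); last by rewrite /p; lia.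
rewrite mulr_sumr -big_split; apply: eq_bigr => k _ /=.
rewrite (_ : N - 1 + k%:Z + 1 = N + k%:Z); last by lia.
rewrite (_ : n - (N - 1 + k%:Z) = n + 1 - (N + k%:Z)); last by lia.
rewrite (_ : n - (N + k%:Z) + 1 = n + 1 - (N + k%:Z)); last by lia.
rewrite [X in _ = _ + X]mulrCA -[X in _ = X + _]mulrA -mulrDl -intrD.
by congr (_%:~R * _); lia.
Qed.

Lemma zshift_linear : linear (@zshift K : L -> powser L).
Proof.
move=> a f g; apply/funext => k; rewrite /zshift.
have it : linear (iter k (@lderiv K) : L -> L).
  by elim: k => [//|k IH] b x y; rewrite !iterS IH lderiv_linear.
by rewrite it scalerDr scalerA mulrC -scalerA.
Qed.

Lemma zshiftS f k : (k.+1)%:R *: zshift f k.+1 = lderiv (zshift f k) :> L.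
Proof.
rewrite /zshift (linear_predZ lderiv_linear) -iterS scalerA; congr (_ *: _).
by rewrite factS natrM invfM mulrA divff ?mul1r// pnatr_eq0.
Qed.

Lemma zshift0 f : zshift f 0 = f.
Proof. by rewrite /zshift fact0 invr1 scale1r. Qed.

(** The map f |-> f(z + x) is multiplicative. By induction on the power k.+1 of x:
    after multiplication by k.+1, which is nonzero in K, the claim is the
    derivative of the previous case, with k.+1 = i + (k.+1 - i) distributed over
    the two factors ([zshiftS]). *)
Lemma zshiftM f g k : zshift (f * g) k = \sum_(i < k.+1) zshift f i * zshift g (k - i)%N.
Proof.
elim: k => [|k IH]; first by rewrite big_ord_recl big_ord0 addr0 !zshift0.
have k0 : k.+1%:R != 0 :> K by rewrite pnatr_eq0.
apply: (scalerI k0); rewrite zshiftS IH (linear_pred_sum lderiv_linear).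
transitivity (\sum_(i < k.+1) (i.+1%:R *: (zshift f i.+1 * zshift g (k - i)%N))
    + \sum_(i < k.+1) ((k - i).+1%:R *: (zshift f i * zshift g (k - i)%N.+1))).
  rewrite -big_split; apply: eq_bigr => i _ /=.
  by rewrite lderivM -!zshiftS scalerAl scalerAr.
rewrite scaler_sumr.
transitivity (\sum_(i < k.+2) (i%:R *: (zshift f i * zshift g (k.+1 - i)%N))
    + \sum_(i < k.+2) ((k.+1 - i)%:R *: (zshift f i * zshift g (k.+1 - i)%N))).
  congr (_ + _); first by rewrite [RHS]big_ord_recl scale0r add0r.
  rewrite [RHS]big_ord_recr /= subnn scale0r addr0; apply: eq_bigr => i _.
  by rewrite subSn // -ltnS.
rewrite -big_split; apply: eq_bigr => i _ /=.
by rewrite -scalerDl -natrD subnKC // -ltnS.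
Qed.

Lemma lderiv1 : lderiv (1 : L) = 0 :> L.
Proof.
apply: laurent_eqP => n.
rewrite -[LHS]/((n + 1)%:~R * (n + 1 == 0)%:R : K) -[RHS]/(0 : K).
by case: eqVneq => [->|_]; rewrite ?mul0r ?mulr0.
Qed.

Lemma zshift1 k : zshift (1 : L) k = (k == 0)%:R.
Proof.
case: k => [|k]; first by rewrite zshift0.
rewrite /zshift iterSr lderiv1 (_ : iter k _ _ = 0) ?scaler0//.
by elim: k => [//|k IH]; rewrite iterS IH (linear_pred0 lderiv_linear).
Qed.

End Derivative.

(** * The action of power series on Laurent series with tensor coefficients *)

Section SeriesAction.
Variables (K : numFieldType) (V : vertexData K).
Local Notation L := (lalg K).
Local Notation T := (tensor L V).
Implicit Types (F G : powser L) (S : laurent T) (f g : L) (t s : T).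

Lemma escale_bilinear : is_bilinear (@escale K L V : L -> T -> T).
Proof.
split=> [t a f g|g]; last exact: escale_linear.
rewrite /= [LHS](@escaleDl K L V); congr (_ + _).
move: t; apply: tensor_additive_eq => [x y|x y|h v].
- exact: (@escaleDr K L V).
- by rewrite (@escaleDr K L V) scalerDr.
- by rewrite !escale_pure -scalerAl pureZl.
Qed.

Lemma psact_trunc F S (N n : int) (p : nat) :
  (forall m : int, m < N -> lcoef S m = 0) -> n < N + p%:Z ->
  lcoef (psact F S) n = \sum_(k < p) escale (F k) (lcoef S (n - k%:Z)).
Proof.
move=> SN np; rewrite /psact /=; apply: (@fsum_ord T) => k pk.
rewrite SN; last by lia.
exact: (linear_pred0 (escale_bilinear.2 (F k))).
Qed.

Lemma psact_bilinear : is_bilinear (@psact K V : powser L -> laurent T -> laurent T).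
Proof.
split=> [S a F G|F a S S']; apply: laurent_eqP => n; rewrite lcoefD lcoefZ.
  have [N SN] := laurentP S; pose p := `|(n - N)%R|%N.+1.
  have np : n < N + p%:Z by rewrite /p; lia.
  rewrite !(psact_trunc _ SN np) scaler_sumr -big_split; apply: eq_bigr => k _ /=.
  exact: (escale_bilinear.1 _ a (F k) (G k)).
have [N [SN SN']] := lcommon_bound S S'; pose p := `|(n - N)%R|%N.+1.
have np : n < N + p%:Z by rewrite /p; lia.
have SSN : forall m : int, m < N -> lcoef (a *: S + S') m = 0.
  by move=> m mN; rewrite lcoefD lcoefZ SN ?SN'// scaler0 addr0.
rewrite (psact_trunc _ SN np) (psact_trunc _ SN' np) (psact_trunc _ SSN np).
rewrite scaler_sumr -big_split; apply: eq_bigr => k _ /=.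
exact: (escale_bilinear.2 (F k) a).
Qed.

(** The double sum over i and j is rearranged along k = i + j into one over
    i <= k; truncating k at p forces j < p - i. *)
Lemma psactA F G S :
  psact F (psact G S) = psact (fun k => \sum_(i < k.+1) F i * G (k - i)%N) S.
Proof.
have [N SN] := laurentP S; apply: laurent_eqP => n; pose p := `|(n - N)%R|%N.+1.
have np : n < N + p%:Z by rewrite /p; lia.
have GSN : forall m : int, m < N -> lcoef (psact G S) m = 0.
  by move=> m mN; rewrite (@psact_trunc _ _ N m 0%N SN) ?big_ord0//; lia.
rewrite (psact_trunc _ GSN np) (psact_trunc _ SN np).
transitivity (\sum_(0 <= i < p) \sum_(0 <= k < p | (i <= k)%N)
    escale (F i * G (k - i)%N) (lcoef S (n - k%:Z))); last first.
  rewrite (exchange_big_dep_nat xpredT)//= big_mkord; apply: eq_bigr => k _.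
  rewrite (linear_pred_sum (escale_bilinear.1 _)) -(big_mkord xpredT
    (fun i => escale (F i * G (k - i)%N) (lcoef S (n - k%:Z)))).
  by rewrite (big_nat_widen 0 k.+1 p).
rewrite big_mkord; apply: eq_bigr => i _.
have np' : n - i%:Z < N + (p - i)%N%:Z by have := ltn_ord i; lia.
rewrite (psact_trunc _ SN np') (linear_pred_sum (escale_bilinear.2 _)).
rewrite -(big_mkord xpredT (fun k => escale (F i) (escale (G k) (lcoef S (n - i%:Z - k%:Z))))).
transitivity (\sum_(i <= k < p) escale (F i * G (k - i)%N) (lcoef S (n - k%:Z))); last first.
  by rewrite (big_nat_widenl i 0).
rewrite [RHS](big_addn 0 p i) !big_nat; apply: eq_bigr => k _.
by rewrite escaleA addnK; congr (escale _ (lcoef S _)); lia.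
Qed.

Lemma ltens_bilinear : is_bilinear (@ltens K V : L -> laurent V -> laurent T).
Proof.
split=> [w a f g|f a w w']; apply: laurent_eqP => n.
  by rewrite lcoefD lcoefZ /= pureDl pureZl.
by rewrite lcoefD lcoefZ /= pureDr pureZr.
Qed.

Lemma psact_ltens F g w : psact F (ltens g w) = pstens (V := V) (fun k => F k * g) w.
Proof.
apply: laurent_eqP => n /=; apply: (@eq_fsbigr T) => k _; exact: escale_pure.
Qed.

(** Reduces every statement about [pstens] to the action [psact]. *)
Lemma pstens_psact F w : pstens F w = psact F (ltens (1 : L) w) :> laurent T.
Proof. by rewrite psact_ltens; congr pstens; apply/funext => k; rewrite mulr1. Qed.

Lemma pstens_bilinear : is_bilinear (@pstens K V : powser L -> laurent V -> laurent T).
Proof.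
split=> [w a F G|F a w w']; rewrite !pstens_psact; first exact: psact_bilinear.1.
by rewrite ltens_bilinear.2 psact_bilinear.2.
Qed.

End SeriesAction.

(** * Vertex operators on the Laurent extension *)

Section VertexOperators.
Variables (K : numFieldType) (V : vertexData K).
Hypothesis V_va : is_vertex_algebra V.
Local Notation L := (lalg K).
Local Notation T := (tensor L V).
Local Notation E := (scalar_ext L V).
Implicit Types (F G : powser L) (S : laurent T) (f g : L) (t s : T) (u v w : V).

Let Y_bilinear := va_bilinear V_va.

Let ltens_vertex_op_bilinear u : is_bilinear (fun (g : L) v => ltens g (vertex_op u v)).
Proof.
split=> [v a f g|g a v w]; first exact: (ltens_bilinear V).1.
by rewrite Y_bilinear.2 (ltens_bilinear V).2.
Qed.

Lemma vertex_op_lin_pure u g v :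
  vertex_op_lin u (g ⊗ v : T) = ltens g (vertex_op u v).
Proof. exact/tens_lift_pure/ltens_vertex_op_bilinear. Qed.

Lemma vertex_op_lin_bilinear : is_bilinear (@vertex_op_lin K V).
Proof.
split=> [s|u]; last exact/tens_lift_linear/ltens_vertex_op_bilinear.
apply: tens_lift_linear_param => g v a u u'.
by rewrite Y_bilinear.1 (ltens_bilinear V).2.
Qed.

Let psact_vertex_op_bilinear s :
  is_bilinear (fun F u => psact F (vertex_op_lin u s)).
Proof.
split=> [u a F G|F a u v]; first exact: (psact_bilinear V).1.
by rewrite vertex_op_lin_bilinear.1 (psact_bilinear V).2.
Qed.

Lemma vertex_op_ext_pure F u s :
  vertex_op_ext (F ⊗ u) s = psact F (vertex_op_lin u s).
Proof. exact: (tens_lift_pure (psact_vertex_op_bilinear s)). Qed.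

Lemma vertex_op_ext_bilinear : is_bilinear (@vertex_op_ext K V).
Proof.
split=> [s|x]; first exact/tens_lift_linear/psact_vertex_op_bilinear.
apply: tens_lift_linear_param => F u a s s'.
by rewrite vertex_op_lin_bilinear.2 (psact_bilinear V).2.
Qed.

Lemma tshift_pure f u : tshift (f ⊗ u : T) = zshift f ⊗ u.
Proof. exact/tens_map_pure/(fun _ _ _ => erefl)/zshift_linear. Qed.

Lemma tshift_linear : linear (@tshift K V).
Proof. exact/tens_map_linear/(fun _ _ _ => erefl)/zshift_linear. Qed.

Let shifted_bilinear f u : is_bilinear (fun (g : L) v =>
  pstens (V := V) (fun k => zshift f k * g) (vertex_op u v)).
Proof.
split=> [v a g h|g a v w]; last by rewrite Y_bilinear.2 (pstens_bilinear V).2.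
rewrite -(pstens_bilinear V).1; congr pstens; apply/funext => k.
by rewrite mulrDr -scalerAr.
Qed.

Let ext_bilinear s : is_bilinear (fun (f : L) u => tens_lift (fun (g : L) v =>
  pstens (V := V) (fun k => zshift f k * g) (vertex_op u v)) s).
Proof.
split=> [u|f]; apply: tens_lift_linear_param => g v a.
  move=> f f'; rewrite -(pstens_bilinear V).1; congr pstens; apply/funext => k.
  by rewrite zshift_linear mulrDl -scalerAl.
by move=> u u'; rewrite Y_bilinear.1 (pstens_bilinear V).2.
Qed.

Lemma ext_vertex_op_bilinear : is_bilinear (@ext_vertex_op K V).
Proof.
split=> [s|t]; first exact/tens_lift_linear/ext_bilinear.
apply: tens_lift_linear_param => f u.
exact/tens_lift_linear/shifted_bilinear.
Qed.

Lemma ext_vertex_op_pure f u g v : ext_vertex_op (f ⊗ u : T) (g ⊗ v) =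
  pstens (fun k => zshift f k * g) (vertex_op u v).
Proof.
rewrite /ext_vertex_op (tens_lift_pure (ext_bilinear _)).
exact/tens_lift_pure/shifted_bilinear.
Qed.

Let ext_Dl s : {morph (@ext_vertex_op K V)^~ s : x y / x + y}.
Proof. exact: (linear_pred_add (ext_vertex_op_bilinear.1 s)). Qed.

Let ext_Dr t : {morph ext_vertex_op t : x y / x + y}.
Proof. exact: (linear_pred_add (ext_vertex_op_bilinear.2 t)). Qed.

(** Both sides are additive in t and s, and on pure tensors both multiply
    Y(u, x)v by f(z + x)g(z). This is what identifies the last axiom of a
    pseudoendomorphism with the homomorphism property. *)
Lemma ext_vertex_opE t s : ext_vertex_op t s = vertex_op_ext (tshift t) s.
Proof.
move: t; apply: tensor_additive_eq => [|x y|f u]; first exact: ext_Dl.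
  rewrite (linear_pred_add tshift_linear).
  exact: (linear_pred_add (vertex_op_ext_bilinear.1 s)).
move: s; apply: tensor_additive_eq => [||g v]; first exact: ext_Dr.
  exact: (linear_pred_add (vertex_op_ext_bilinear.2 _)).
by rewrite ext_vertex_op_pure tshift_pure vertex_op_ext_pure vertex_op_lin_pure psact_ltens.
Qed.

(** The scaling law that propagates the homomorphism property from 1 ⊗ V to
    K((z)) ⊗ V. *)
Lemma ext_vertex_op_scale f g t s : ext_vertex_op (escale f t) (escale g s) =
  psact (fun k => zshift f k * g) (ext_vertex_op t s).
Proof.
have sD h : {morph escale h : x y / x + y >-> (x + y : T)} by exact: (@escaleDr K L V).
have pD F : {morph psact F : x y / x + y >-> (x + y : laurent T)}.
  exact: (linear_pred_add ((psact_bilinear V).2 F)).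
move: t; apply: tensor_additive_eq => [x y|x y|f' u].
- by rewrite sD ext_Dl.
- by rewrite ext_Dl pD.
move: s; apply: tensor_additive_eq => [x y|x y|g' v].
- by rewrite sD ext_Dr.
- by rewrite ext_Dr pD.
rewrite !escale_pure !ext_vertex_op_pure !pstens_psact psactA; congr psact.
apply/funext => k; rewrite zshiftM mulr_suml; apply: eq_bigr => i _.
by rewrite mulrACA.
Qed.

(** V embeds in K((z)) ⊗ V as 1 ⊗ V, since 1(z + x) = 1. *)
Lemma ext_vertex_op_const u v n :
  lcoef (ext_vertex_op (1 ⊗ u : T) (1 ⊗ v)) n = 1 ⊗ lcoef (vertex_op u v) n.
Proof.
rewrite ext_vertex_op_pure /= (@fsum_ord T _ 1); last first.
  by case=> // k _; rewrite zshift1 mul0r pure0l.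
by rewrite big_ord1 zshift1 mul1r subr0.
Qed.

Lemma canonical_D_linear : linear (@canonical_D K V).
Proof. by move=> a u v; rewrite /canonical_D /nprod Y_bilinear.1. Qed.

(** The canonical operator reads the coefficient of x in
    f(z + x) ⊗ Y(u, x)vac. Since Y(u, x)vac = u + (D u)x + ..., and
    f(z + x) = f + f'x + ..., this is f' ⊗ u + f ⊗ D u. *)
Lemma canonical_D_ext t : canonical_D (t : laurent_ext V) =
  tens_map (@lderiv K) id t + tens_map id (@canonical_D K V) t :> T.
Proof.
have lid (W : lmodType K) : linear (@id W) by [].
have l1 := tens_map_linear (@lderiv_linear K) (lid V).
have l2 := tens_map_linear (lid L) canonical_D_linear.
move: t; apply: tensor_additive_eq => [x y|x y|f u].
- by rewrite /canonical_D /nprod [vertex_op _ _]ext_Dl.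
- by rewrite (linear_pred_add l1) (linear_pred_add l2) addrACA.
rewrite (tens_map_pure (@lderiv_linear K) (lid V)).
rewrite (tens_map_pure (lid L) canonical_D_linear).
rewrite {1}/canonical_D /nprod /vertex_op /vac /=.
rewrite ext_vertex_op_pure /= (@fsum_ord T _ 2); last first.
  move=> k k2; rewrite (va_creation V_va u).2 ?pure0r//; lia.
rewrite big_ord_recl big_ord1 zshift0 mulr1 addrC; congr (_ + _).
rewrite (_ : _ - _ = 0); last by [].
rewrite (va_creation V_va u).1 mulr1 -[zshift f _]scale1r.
by rewrite (zshiftS f 0) zshift0.
Qed.


(** * Restriction to V and linear extension *)

Implicit Types (A : V -> T).

(** An endomorphism commutes with the canonical operator, which is
    u |-> u_(-2) vac; this gives the bracket identity at 1 ⊗ v. *)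
Lemma restrict_PEnd (f : T -> T) :
  va_End (laurent_ext V) f -> PEnd V (restrict_to_V f).
Proof.
case=> lf f1 fY.
have lr : linear (restrict_to_V f).
  by move=> a u v; rewrite /restrict_to_V (pure_bilinear L V).2 lf.
split=> // [v|v w n].
  have lid (W : lmodType K) : linear (@id W) by [].
  have fD : f (canonical_D ((1 ⊗ v : T) : laurent_ext V)) =
      canonical_D (f (1 ⊗ v) : laurent_ext V).
    by rewrite /canonical_D /nprod fY f1.
  have D1 : tens_map (@lderiv K) id (1 ⊗ v : T) = 0.
    by rewrite (tens_map_pure (@lderiv_linear K) (lid V)) lderiv1 pure0l.
  move: fD; rewrite !canonical_D_ext D1 add0r.
  rewrite (tens_map_pure (lid L) canonical_D_linear) /restrict_to_V => ->.
  by rewrite opprD addrCA subrr addr0.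
by rewrite /restrict_to_V -ext_vertex_opE -(fY (1 ⊗ v) (1 ⊗ w)) -ext_vertex_op_const.
Qed.

Let escale_A_bilinear A : linear A ->
  is_bilinear (fun (g : L) v => (g *: (A v : E) : T)).
Proof.
move=> lA; split=> [v|g a v w]; first exact: (escale_bilinear V).1.
by rewrite lA; exact: (escale_bilinear V).2.
Qed.

Lemma linear_ext_pure A g v : linear A -> linear_ext A (g ⊗ v) = escale g (A v).
Proof. by move=> lA; exact: (tens_lift_pure (escale_A_bilinear lA)). Qed.

Lemma linear_ext_linear A : linear A -> linear (linear_ext A).
Proof. by move=> lA; exact: (tens_lift_linear (escale_A_bilinear lA)). Qed.

Lemma linear_ext_escale A g t :
  linear A -> linear_ext A (escale g t) = escale g (linear_ext A t).
Proof.
move=> lA; have lD := linear_pred_add (linear_ext_linear lA).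
have sD h : {morph escale h : x y / x + y >-> (x + y : T)} by exact: (@escaleDr K L V).
move: t; apply: tensor_additive_eq => [x y|x y|f v]; first by rewrite sD lD.
  by rewrite lD sD.
by rewrite escale_pure !linear_ext_pure// escaleA.
Qed.

Lemma linear_extK A : linear A -> restrict_to_V (linear_ext A) = A.
Proof.
move=> lA; apply/funext => v.
by rewrite /restrict_to_V linear_ext_pure// escale1.
Qed.

(** By additivity it is enough to treat f ⊗ u and g ⊗ v, where
    f(z + x)g(z) can be pulled out of both sides, leaving the defining identity
    of a pseudoendomorphism. *)
Lemma linear_ext_End A : PEnd V A -> va_End (laurent_ext V) (linear_ext A).
Proof.
case=> lA A1 _ AY; have lE := linear_ext_linear lA.
have lD := linear_pred_add lE.
split=> //; first by rewrite linear_ext_pure// A1 escale1.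
move=> t s n; rewrite /vertex_op /=.
move: t; apply: tensor_additive_eq => [x y|x y|f u].
- by rewrite ext_Dl lcoefD lD.
- by rewrite lD ext_Dl.
move: s; apply: tensor_additive_eq => [x y|x y|g v].
- by rewrite ext_Dr lcoefD lD.
- by rewrite lD ext_Dr.
rewrite !linear_ext_pure// ext_vertex_op_scale ext_vertex_op_pure.
(* The two series in x have different lower bounds; p is large enough to
   truncate both sums at the same place. *)
have [N wN] := laurentP (vertex_op u v).
have [P SP] := laurentP (ext_vertex_op (A u) (A v)).
pose p := (`|(n - N)%R| + `|(n - P)%R|)%N.+1.
rewrite (psact_trunc _ SP (_ : n < P + p%:Z)); last by rewrite /p; lia.
rewrite /= (@fsum_ord T _ p); last first.
  by move=> k pk; rewrite wN ?pure0r//; rewrite /p in pk; lia.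
rewrite (linear_pred_sum lE); apply: eq_bigr => k _.
by rewrite linear_ext_pure// AY -ext_vertex_opE.
Qed.

Lemma linear_ext_End_Laurent A : PEnd V A -> va_End_Laurent V (linear_ext A).
Proof.
move=> PA; have lA : linear A by case: PA.
split; first exact: linear_ext_End.
move=> g t s; rewrite (linear_pred_add (linear_ext_linear lA)); congr (_ + _).
exact: linear_ext_escale.
Qed.

Lemma restrict_to_VK (f : T -> T) : linear (f : E -> E) -> linear f ->
  linear_ext (restrict_to_V f) = f.
Proof.
move=> lLf lf.
have lr : linear (restrict_to_V f).
  by move=> a u v; rewrite /restrict_to_V (pure_bilinear L V).2 lf.
apply/funext; apply: tensor_additive_eq => [||g v].
- exact: (linear_pred_add (linear_ext_linear lr)).
- exact: (linear_pred_add lf).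
rewrite linear_ext_pure// /restrict_to_V.
have -> : g ⊗ v = escale g (1 ⊗ v) :> T by rewrite escale_pure mulr1.
exact/esym/(linear_predZ lLf).
Qed.

End VertexOperators.

Theorem proposition2p11 (R : realType) (V : vertexData R[i])
    (V_va : is_vertex_algebra V) :
  [/\ forall f, va_End (laurent_ext V) f -> PEnd V (restrict_to_V f),
      forall A, PEnd V A -> va_End (laurent_ext V) (linear_ext A)
    & [/\ @restrict_to_V _ V @` va_End_Laurent V = PEnd V,
          @linear_ext _ V @` PEnd V = va_End_Laurent V,
          (forall f, va_End_Laurent V f -> linear_ext (restrict_to_V f) = f)
        & (forall A, PEnd V A -> restrict_to_V (linear_ext A) = A)]].
Proof.
have rP f : va_End (laurent_ext V) f -> PEnd V (restrict_to_V f).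
  exact: restrict_PEnd.
have eP A : PEnd V A -> va_End_Laurent V (linear_ext A).
  exact: linear_ext_End_Laurent.
have rK f : va_End_Laurent V f -> linear_ext (restrict_to_V f) = f.
  by case=> -[lf _ _] lLf; exact: restrict_to_VK.
have eK A : PEnd V A -> restrict_to_V (linear_ext A) = A.
  by case=> lA _ _ _; exact: linear_extK.
split=> // [A /eP[]//|]; split=> //; apply/seteqP; split.
- by move=> _ [f [fE _] <-]; exact: rP.
- by move=> A PA; exists (linear_ext A); [exact: eP | exact: eK].
- by move=> _ [A PA <-]; exact: eP.
- by move=> f fE; exists (restrict_to_V f); [case: fE => /rP | exact: rK].
Qed.
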